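(* Let $\Theta=(\theta_1,\theta_2,\theta_3)\in\mathbb{R}^3$ be such that the numbers $1,\theta_1,\theta_2,\theta_3$ are linearly independent over $\mathbb{Z}$. Then $$ \beta(\Theta)\geqslant \alpha(\Theta)\, g_3(\alpha(\Theta)),\qquad\text{where}\qquad g_3(\alpha)=\frac{1}{2}\left(\frac{\alpha}{1-\alpha}+\sqrt{\left(\frac{\alpha}{1-\alpha}\right)^2+\frac{4\alpha}{1-\alpha}}\right). $$
   Context: For a real number $u$, $\|u\|$ denotes the distance from $u$ to the nearest integer. For $\Theta=(\theta_1,\theta_2,\theta_3)$ and real $t\geqslant 1$ put $\psi_\Theta(t)=\min_{x}\max_{1\leqslant i\leqslant 3}\|\theta_i x\|$, the minimum taken over positive integers $x\leqslant t$. The uniform Diophantine exponent is $\alpha(\Theta)=\sup\{\gamma>0:\ \limsup_{t\to+\infty} t^\gamma\psi_\Theta(t)<+\infty\}$, and the ordinary Diophantine exponent is $\beta(\Theta)=\sup\{\gamma>0:\ \liminf_{t\to+\infty} t^\gamma\psi_\Theta(t)<+\infty\}$. It is known that $\frac13\leqslant\alpha(\Theta)\leqslant 1$. *)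

(* Defs.v *)
From HB Require Import structures.
From mathcomp Require Import all_boot all_order all_algebra.
From mathcomp Require Import all_classical all_reals all_analysis.
Set Implicit Arguments. Unset Strict Implicit. Unset Printing Implicit Defensive.
Import Order.TTheory GRing.Theory Num.Theory.
Local Open Scope ring_scope.
Local Open Scope classical_set_scope.

Section Defs.
Variable R : realType.

Definition dnint (u : R) : R :=
  Num.min (u - (Num.floor u)%:~R) ((Num.floor u)%:~R + 1 - u).

Definition maxdist (t1 t2 t3 : R) (x : nat) : R :=
  Num.max (dnint (t1 * x%:R)) (Num.max (dnint (t2 * x%:R)) (dnint (t3 * x%:R))).

(* psi_Theta(t) = min over positive integers x <= t (meaningful for t >= 1) *)
Definition psi (t1 t2 t3 : R) (t : R) : R :=
  \big[Num.min/maxdist t1 t2 t3 1]_(1 <= x < (Num.truncn t).+1) maxdist t1 t2 t3 x.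

Definition limsup_finite (t1 t2 t3 g : R) : Prop :=
  exists C : R, exists T : R, forall t : R, T <= t -> 1 <= t ->
    t `^ g * psi t1 t2 t3 t <= C.

Definition liminf_finite (t1 t2 t3 g : R) : Prop :=
  exists C : R, forall T : R, exists t : R, T <= t /\ 1 <= t /\
    t `^ g * psi t1 t2 t3 t <= C.

Definition alpha_exp (t1 t2 t3 : R) : \bar R :=
  ereal_sup [set (g%:E) | g in [set g : R | 0 < g /\ limsup_finite t1 t2 t3 g]].

Definition beta_exp (t1 t2 t3 : R) : \bar R :=
  ereal_sup [set (g%:E) | g in [set g : R | 0 < g /\ liminf_finite t1 t2 t3 g]].

Definition g3 (a : R) : R :=
  let r := a / (1 - a) in (r + Num.sqrt (r ^+ 2 + 4 * r)) / 2.

Definition Zlin_indep4 (t1 t2 t3 : R) : Prop :=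
  forall a0 a1 a2 a3 : int,
    a0%:~R + a1%:~R * t1 + a2%:~R * t2 + a3%:~R * t3 = 0 ->
    [/\ a0 = 0, a1 = 0, a2 = 0 & a3 = 0].

End Defs.

(* Main.v *)
(** Let [z_n = (q_n, p_n)] be the best approximation vectors in [Z^4], with
    errors [e_n]. Among them one finds, arbitrarily far out, indices [a < n]
    such that [z_a, z_n, z_{n+1}, z_{n+2}] are linearly independent while
    [z_{a+1}, z_{a+2}] lie in the plane of [z_n, z_{n+1}]. The nonzero
    determinant gives [1 << q_{n+2} e_{n+1} e_n e_a], and comparing the areas
    of two bases of the plane lattice gives [e_n q_{n+1} << e_{a+1} q_{a+2}].
    With [e_j << q_{j+1}^{-gam}] these yield [1 << (q_{n+2} q_{a+2})^{1-gam}
    q_{n+1}^{-1} q_{a+1}^{-gam}], which is incompatible with [q_{j+1} < q_j^g]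
    for all large [j] as soon as [g^2 < gam (1 + g + g^2)], that is, [g < g3
    gam]. Hence [q_{j+1} >= q_j^g], and so [e_j << q_j^{-gam g}], for
    infinitely many [j]. *)
Require Import Defs.
From HB Require Import structures.
From mathcomp Require Import all_boot all_order all_algebra perm.
From mathcomp Require Import all_classical all_reals all_analysis.
From mathcomp Require Import ring lra zify.
Set Implicit Arguments. Unset Strict Implicit. Unset Printing Implicit Defensive.
Import Order.TTheory GRing.Theory Num.Theory.
Local Open Scope ring_scope.

(** * Determinants and spans of finitely many vectors *)

(** Each of the n! terms of the Leibniz expansion is at most the product of the row bounds. *)
Lemma norm_det_le (R : realDomainType) n (A : 'M[R]_n) (r : 'I_n -> R) :
  (forall i j, `|A i j| <= r i) -> `|\det A| <= n`!%:R * \prod_i r i.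
Proof.
move=> Ar; apply: le_trans (ler_norm_sum _ _ _) _.
have -> : n`!%:R * \prod_i r i = \sum_(s : 'S_n) \prod_i r i.
  by rewrite sumr_const -[in LHS]card_Sn mulr_natl; congr (_ *+ _); apply: eq_card.
apply: ler_sum => s _; rewrite normrM normr_sign mul1r normr_prod.
by apply: ler_prod => i _; rewrite normr_ge0 Ar.
Qed.

Lemma nonfull_rank_annihilated (F : fieldType) m n (A : 'M[F]_(m, n)) :
  (\rank A < n)%N -> exists2 c : 'cV_n, c != 0 & A *m c = 0.
Proof.
move=> rA; have : kermx A^T != 0.
  by rewrite -mxrank_eq0 mxrank_ker mxrank_tr subn_eq0 -ltnNge.
case/rowV0Pn => v /sub_kermxP vA v0.
exists v^T; first by rewrite -trmx0 (inj_eq trmx_inj).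
by apply: trmx_inj; rewrite trmx_mul trmxK vA trmx0.
Qed.

(** The ranks of the spans of z_m, ..., z_N are bounded by n. Where the rank is maximal, the span
    contains every later z_j, so a functional that vanishes on this window vanishes on the whole
    tail. *)
Lemma finite_span_separated (F : fieldType) n (z : nat -> 'rV[F]_n) m :
  (forall c : 'cV_n, c != 0 -> exists2 j, (m <= j)%N & z j *m c != 0) ->
  exists N, forall c : 'cV_n, c != 0 ->
    exists2 j, (m <= j <= N)%N & z j *m c != 0.
Proof.
move=> zc; pose V N := (\sum_(m <= j < N) <<z j>>)%MS.
have exP : exists r, `[< exists N, \rank (V N) = r >].
  by exists (\rank (V 0%N)); apply/asboolP; exists 0%N.
have ubP r : `[< exists N, \rank (V N) = r >] -> (r <= n)%N.
  by move=> /asboolP[N <-]; apply: rank_leq_row.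
case: (ex_maxnP exP ubP) => _ /asboolP[N <-] rmax.
have subV N1 : (V N <= V (maxn N N1))%MS.
  have [mN|Nm] := leqP m N; last by rewrite /V big_geq ?sub0mx // ltnW.
  by rewrite /V (@big_cat_nat _ _ _ N m (maxn N N1)) //= ?leq_maxl // addsmxSl.
have inV j : (m <= j)%N -> (z j <= V N)%MS.
  move=> mj; have := mxrank_leqif_sup (subV j.+1) => H.
  have : (V (maxn N j.+1) <= V N)%MS.
    rewrite -H eqn_leq mxrankS //= rmax //; apply/asboolP.
    by exists (maxn N j.+1).
  apply: submx_trans; rewrite /V (@big_cat_nat _ _ _ j.+1 m) //=; last 2 first.
  - exact: leqW.
  - exact: leq_maxr.
  apply: submx_trans (addsmxSl _ _); rewrite big_nat_recr //=.
  by apply: submx_trans (addsmxSr _ _); rewrite genmxE.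
exists N => c /zc[j0 mj0 zc0]; apply: contrapT => nz.
have Vc : V N *m c = 0.
  apply/sub_kermxP; rewrite /V big_seq.
  elim/big_ind: _ => [|A B HA HB|j]; [exact: sub0mx|by rewrite addsmx_sub HA|].
  rewrite mem_index_iota => /andP[mj jN]; rewrite genmxE.
  apply/sub_kermxP/eqP; apply: contrapT => /negP zjc.
  by apply: nz; exists j => //; rewrite mj ltnW.
by case/submxP: (inV _ mj0) zc0 => D ->; rewrite -mulmxA Vc mulmx0 eqxx.
Qed.

Definition rows4 {T : Type} {n} (u v w x : 'rV[T]_n) : 'M[T]_(4, n) :=
  \matrix_(i < 4, j < n) tnth [tuple u; v; w; x] i ord0 j.

Lemma mul_rows4 (F : nzRingType) n (l : 'rV[F]_4) (u v w x : 'rV[F]_n) :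
  l *m rows4 u v w x = l 0 (inord 0) *: u + l 0 (inord 1) *: v
    + l 0 (inord 2) *: w + l 0 (inord 3) *: x.
Proof.
apply/rowP => j; rewrite !mxE !big_ord_recl big_ord0 /= addr0 !addrA.
rewrite !mxE /= !(tnth_nth 0) /=.
by do !congr (_ + _); congr (l _ _ * _); apply: val_inj; rewrite [RHS]inordK.
Qed.

(* [n.+2] is the first index at which the vectors from index [m] on span the
   whole space, and [a] is the last index below [n] with [z a] outside the
   plane of [z n] and [z n.+1]. *)
Lemma four_independent (F : fieldType) (z : nat -> 'rV[F]_4) m :
  (forall j s t, s *: z j + t *: z j.+1 = 0 -> s = 0 /\ t = 0) ->
  (forall c : 'cV_4, c != 0 -> exists2 j, (m <= j)%N & z j *m c != 0) ->
  exists a n, [/\ (m <= a < n)%N,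
    (exists s t, z a.+1 = s *: z n + t *: z n.+1),
    (exists s t, z a.+2 = s *: z n + t *: z n.+1) &
    \det (rows4 (z a) (z n) (z n.+1) (z n.+2)) != 0].
Proof.
move=> zind /finite_span_separated[N0 zN0].
pose sep N := forall c : 'cV_4, c != 0 ->
  exists2 j, (m <= j <= N)%N & z j *m c != 0.
have exP : exists N, `[< sep N >] by exists N0; apply/asboolP.
case: (ex_minnP exP) => N /asboolP sepN Nmin {exP N0 zN0}.
have small (s : seq nat) : (size s < 4)%N -> exists2 c : 'cV_4, c != 0 &
    forall j, j \in s -> z j *m c = 0.
  move=> s4; pose A := \matrix_(i < size s) z (tnth (in_tuple s) i).
  have [c c0 Ac] : exists2 c : 'cV_4, c != 0 & A *m c = 0.
    by apply: nonfull_rank_annihilated; apply: leq_ltn_trans (rank_leq_row _) _.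
  exists c => // j js; have /tnthP[i ->] : j \in in_tuple s by [].
  by rewrite -[z _](rowK (fun i => z (tnth (in_tuple s) i))) -row_mul Ac row0.
have mN : (m + 2 < N)%N.
  rewrite ltnNge; apply/negP => Nm.
  have [c /sepN[j /andP[mj jN] zjc] cz] := small [:: m; m.+1; m.+2] isT.
  case/negP: zjc; apply/eqP/cz; rewrite !inE.
  by move: (leq_trans jN Nm) mj; lia.
have [n defN] : exists n, N = n.+2 by exists N.-2; lia.
subst N; have mn : (m < n)%N by lia.
(* Since [n.+2] is the least separating bound, some nonzero functional kills every vector from index
   [m] to [n.+1]. *)
have [c c0 cz] : exists2 c : 'cV_4, c != 0 &
    forall j, (m <= j <= n.+1)%N -> z j *m c = 0.
  apply: contrapT => nc.
  have : sep n.+1.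
    move=> c c0; apply: contrapT => nj; apply: nc; exists c => // j mj.
    by apply/eqP; apply: contrapT => /negP zj; apply: nj; exists j.
  by move=> /asboolP /Nmin; rewrite ltnn.
have zc : z n.+2 *m c != 0.
  have [j /andP[mj jn] zj] := sepN _ c0.
  suff <- : j = n.+2 by [].
  apply/eqP; rewrite eqn_leq jn ltnNge; apply: contra zj => jn1.
  by rewrite cz ?eqxx // mj.
pose W := (z n + z n.+1)%MS.
(* Otherwise z_n, z_{n+1}, z_{n+2} would span the whole window, and three vectors in dimension four
   are killed by a nonzero functional. *)
have [a0 /andP[ma0 an0] za0] : exists2 a, (m <= a < n)%N & ~~ (z a <= W)%MS.
  apply: contrapT => na.
  have [d /sepN[j /andP[mj jn] zjd] dz] := small [:: n; n.+1; n.+2] isT.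
  case/negP: zjd; apply/eqP; case: (ltnP j n) => jn'; last first.
    by apply: dz; rewrite !inE; move: jn jn'; lia.
  have : (z j <= W)%MS by apply: contrapT => /negP ?; apply: na; exists j; rewrite ?mj.
  case/sub_addsmxP => -[D1 D2] ->.
  by rewrite mulmxDl -!mulmxA !dz ?inE ?eqxx ?orbT // !mulmx0 addr0.
have exA : exists a, (a < n)%N && ~~ (z a <= W)%MS by exists a0; rewrite an0.
have ubA a : (a < n)%N && ~~ (z a <= W)%MS -> (a <= n)%N by case/andP=> /ltnW.
case: (ex_maxnP exA ubA) => a /andP[an za] amax.
have inW j : (a < j <= n.+1)%N -> exists s t, z j = s *: z n + t *: z n.+1.
  case/andP=> aj jn; have : (z j <= W)%MS.
    case: (ltnP j n) => jn'.
      apply: contrapT => /negP zj; have := amax j.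
      by rewrite jn' zj => /(_ isT); rewrite leqNgt aj.
    have [->|->] : j = n \/ j = n.+1 by lia.
      exact: addsmxSl.
    exact: addsmxSr.
  case/sub_addsmxP => -[D1 D2] /= ->; exists (D1 0 0), (D2 0 0).
  by rewrite [D1 in LHS]mx11_scalar [D2 in LHS]mx11_scalar !mul_scalar_mx.
have ma : (m <= a)%N by rewrite (leq_trans ma0) // amax // an0.
exists a, n; split; [by rewrite ma|apply: inW; lia|apply: inW; lia|].
apply/negP => /det0P[l l0]; rewrite mul_rows4.
(* Applying [c] to the relation isolates the coefficient of z_{n+2}; that of z_a vanishes next
   because z_a lies outside the plane [W]. *)
move=> lz; have l3 : l 0 (inord 3) = 0.
  have := congr1 (mulmx^~ c) lz; rewrite /= !mulmxDl -!scalemxAl mul0mx.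
  rewrite (cz a) ?(cz n) ?(cz n.+1) ?scaler0 ?add0r; [|lia..].
  by move=> /eqP; rewrite scaler_eq0 (negbTE zc) orbF => /eqP.
move: lz; rewrite l3 scale0r addr0 => lz.
have l1 : l 0 (inord 0) = 0.
  apply/eqP; apply: contraNT za => lne.
  have -> : z a = (- (l 0 (inord 0))^-1 * l 0 (inord 1)) *: z n
      + (- (l 0 (inord 0))^-1 * l 0 (inord 2)) *: z n.+1.
    rewrite -!scalerA -scalerDr scaleNr -scalerN; apply: (scalerI lne).
    rewrite scalerA mulfV // scale1r; apply/eqP; rewrite -subr_eq0 opprK addrA.
    exact/eqP.
  by apply: addmx_sub_adds; apply: scalemx_sub.
move: lz; rewrite l1 scale0r add0r => /zind[l2 l4].
case/negP: l0; apply/eqP/rowP => i; rewrite mxE.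
have -> : i = inord i by rewrite inord_val.
by case: i => -[|[|[|[|//]]]] Hi /=.
Qed.

(** * Best approximations and the lattice planes of consecutive ones *)

(** [ba_min] allows arbitrary integers [k], so it applies to integer combinations of approximation
    vectors; at [x = q n] it makes [e n] the exact error. [ba_err0] serves to exclude nonzero
    integer vectors with first coordinate 0. *)
Record best_approximations (R : realType) d (theta : 'I_d -> R)
    (q : nat -> nat) (p : nat -> 'I_d -> int) (e : nat -> R) : Prop := {
  ba_pos : (0 < q 0)%N;
  ba_ltn n : (q n < q n.+1)%N;
  ba_err0 : e 0%N <= 2^-1;
  ba_err_gt0 n : 0 < e n;
  ba_err_lt n : e n.+1 < e n;
  ba_approx n i : `|theta i * (q n)%:R - (p n i)%:~R| <= e n;
  ba_min n x (k : 'I_d -> int) : (0 < x < q n.+1)%N ->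
    exists i, e n <= `|theta i * x%:R - (k i)%:~R| }.

Lemma ba_gt0 {R : realType} {d} {theta : 'I_d -> R} {q p e}
  (ba : best_approximations theta q p e) n : (0 < q n)%N.
Proof.
by elim: n => [|n IH]; [exact: ba_pos ba|exact: ltn_trans IH (ba_ltn ba n)].
Qed.

Lemma ba_leq {R : realType} {d} {theta : 'I_d -> R} {q p e}
  (ba : best_approximations theta q p e) m n : (m <= n)%N -> (q m <= q n)%N.
Proof. by apply: homo_leq leqnn leq_trans _ m n => k; exact: ltnW (ba_ltn ba k). Qed.

Lemma ba_index_lt {R : realType} {d} {theta : 'I_d -> R} {q p e}
  (ba : best_approximations theta q p e) n : (n < q n)%N.
Proof.
by elim: n => [|n IH]; [exact: ba_pos ba|exact: leq_ltn_trans IH (ba_ltn ba n)].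
Qed.

Lemma ba_err_le {R : realType} {d} {theta : 'I_d -> R} {q p e}
  (ba : best_approximations theta q p e) m n : (m <= n)%N -> e n <= e m.
Proof.
apply: (homo_leq (r := fun x y => y <= x)) => [x|y x z xy yz|k] //.
  exact: le_trans yz xy.
exact: ltW (ba_err_lt ba k).
Qed.

(* The coordinates of the bivector [z_n /\ z_{n+1}] that involve the
   [q]-component; their maximum measures the area of the lattice parallelogram.
   *)
Definition plucker {d} (q : nat -> nat) (p : nat -> 'I_d -> int) n i : int :=
  (q n.+1)%:Z * p n i - (q n)%:Z * p n.+1 i.

(** The products theta_i q_n q_{n+1} cancel, which expresses an integer through two approximation
    errors. *)
Lemma pluckerE (R : realType) d (theta : 'I_d -> R) q p n i :
  (plucker q p n i)%:~R =
    (q n)%:R * (theta i * (q n.+1)%:R - (p n.+1 i)%:~R)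
    - (q n.+1)%:R * (theta i * (q n)%:R - (p n i)%:~R) :> R.
Proof. by rewrite /plucker rmorphB !rmorphM /= -!pmulrn; ring. Qed.

Lemma plucker_le {R : realType} {d} {theta : 'I_d -> R} {q p e}
    (ba : best_approximations theta q p e) n i :
  `|(plucker q p n i)%:~R| <= 2 * ((q n.+1)%:R * e n).
Proof.
rewrite (pluckerE theta); apply: le_trans (ler_normB _ _) _.
rewrite !normrM !normr_nat.
have := ba_approx ba n i; have := ba_approx ba n.+1 i.
have := ba_err_lt ba n; have := ba_err_gt0 ba n.
have : (q n)%:R < (q n.+1)%:R :> R by rewrite ltr_nat (ba_ltn ba).
have : 0 <= (q n)%:R :> R by [].
nra.
Qed.

(* When [q n.+1 < 2 * q n] the two terms of [pluckerE] could cancel; minimality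
   is then applied to [z_{n+1} - z_n], which spans the same area with
   [z_{n+1}]. *)
Lemma plucker_ge {R : realType} {d} {theta : 'I_d -> R} {q p e}
    (ba : best_approximations theta q p e) n :
  exists i, (q n.+1)%:R * e n <= 2 * `|(plucker q p n i)%:~R|.
Proof.
have qn := ba_ltn ba n; have q0 := ba_gt0 ba n.
have e0 := ba_err_gt0 ba n; have e1 := ba_err_lt ba n.
(* In either case the subtracted term carries a factor at most q_{n+1}/2 and an error below e_n;
   hence the constant 2. *)
have [q2|q2] := leqP (q n).*2 (q n.+1).
  have [i Hi] := ba_min ba (p n) (x := q n) (n := n) (ltac: (by rewrite q0)).
  exists i; rewrite (pluckerE theta) distrC.
  have Hi1 := ba_approx ba n.+1 i.
  apply: le_trans (_ : 2 * (`|(q n.+1)%:R * (theta i * (q n)%:R - (p n i)%:~R)|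
    - `|(q n)%:R * (theta i * (q n.+1)%:R - (p n.+1 i)%:~R)|) <= _); last first.
    by rewrite ler_pM2l // lerB_dist.
  rewrite !normrM !normr_nat.
  have : 2 * (q n)%:R <= (q n.+1)%:R :> R by rewrite -natrM ler_nat mul2n.
  have : 0 <= (q n)%:R :> R by [].
  nra.
have qd : (0 < q n.+1 - q n < q n.+1)%N by lia.
have [i Hi] := ba_min ba (fun i => p n.+1 i - p n i) qd.
exists i; rewrite (pluckerE theta).
have Hi1 := ba_approx ba n.+1 i.
have -> : (q n)%:R * (theta i * (q n.+1)%:R - (p n.+1 i)%:~R)
    - (q n.+1)%:R * (theta i * (q n)%:R - (p n i)%:~R)
  = (q n.+1)%:R * (theta i * (q n.+1 - q n)%:R - (p n.+1 i - p n i)%:~R)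
    - (q n.+1 - q n)%:R * (theta i * (q n.+1)%:R - (p n.+1 i)%:~R) :> R.
  by rewrite natrB ?(ltnW qn) // rmorphB /=; ring.
apply: le_trans (_ : 2 * (`|(q n.+1)%:R * (theta i * (q n.+1 - q n)%:R
     - (p n.+1 i - p n i)%:~R)| - `|(q n.+1 - q n)%:R *
     (theta i * (q n.+1)%:R - (p n.+1 i)%:~R)|) <= _); last first.
  by rewrite ler_pM2l // lerB_dist.
rewrite !normrM !normr_nat.
have : 2 * (q n.+1 - q n)%:R <= (q n.+1)%:R :> R by rewrite -natrM ler_nat; lia.
have : 0 <= (q n.+1 - q n)%:R :> R by [].
nra.
Qed.

Lemma plucker_neq0 {R : realType} {d} {theta : 'I_d -> R} {q p e}
    (ba : best_approximations theta q p e) n : exists i, plucker q p n i != 0.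
Proof.
have [i Hi] := plucker_ge ba n; exists i; apply/negP => /eqP p0.
move: Hi; rewrite p0 normr0 mulr0; apply/negP; rewrite -ltNge mulr_gt0 //.
  by rewrite ltr0n (ba_gt0 ba).
exact: ba_err_gt0 ba n.
Qed.

(** Eliminating [t] leaves [s] times a nonzero Plücker coordinate. The scalars are general because
    both real and rational ones occur later. *)
Lemma ba_independent {R : realType} {d} {theta : 'I_d -> R} {q p e}
    (ba : best_approximations theta q p e) (F : numDomainType) n (s t : F) :
  s * (q n)%:R + t * (q n.+1)%:R = 0 ->
  (forall i, s * (p n i)%:~R + t * (p n.+1 i)%:~R = 0) -> s = 0 /\ t = 0.
Proof.
move=> Hq Hp; have [i Hi] := plucker_neq0 ba n.
have s0 : s = 0.
  apply/eqP; have : s * (plucker q p n i)%:~R = 0.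
    transitivity ((q n.+1)%:R * (s * (p n i)%:~R + t * (p n.+1 i)%:~R)
      - (p n.+1 i)%:~R * (s * (q n)%:R + t * (q n.+1)%:R)).
      by rewrite /plucker rmorphB !rmorphM /= -!pmulrn; ring.
    by rewrite Hq Hp !mulr0 subr0.
  by move/eqP; rewrite mulf_eq0 intr_eq0 (negbTE Hi) orbF.
split=> //; move/eqP: Hq; rewrite s0 mul0r add0r mulf_eq0 pnatr_eq0.
by rewrite -[q _ == _]negbK -lt0n (ba_gt0 ba) orbF => /eqP.
Qed.

Lemma nearest_int (R : realType) (x : R) : exists m : int, `|x - m%:~R| <= 2^-1.
Proof.
exists (Num.floor (x + 2^-1)); have := floor_itv (x + 2^-1).
by rewrite rmorphD /= => /andP[? ?]; rewrite ler_norml; apply/andP; split; lra.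
Qed.

(* Otherwise reducing the coordinates modulo 1 to [-1/2, 1/2] would give a
   nonzero integer vector that contradicts the minimality of the pair. *)
Lemma ba_basis {R : realType} {d} {theta : 'I_d -> R} {q p e}
    (ba : best_approximations theta q p e) n (x : int) (k : 'I_d -> int) (s t : R) :
  x%:~R = s * (q n)%:R + t * (q n.+1)%:R ->
  (forall i, (k i)%:~R = s * (p n i)%:~R + t * (p n.+1 i)%:~R) ->
  exists s' t' : int, s = s'%:~R /\ t = t'%:~R.
Proof.
move=> Hx Hk; have [s' Hs] := nearest_int s; have [t' Ht] := nearest_int t.
exists s', t'.
pose y := x - s' * (q n)%:Z - t' * (q n.+1)%:Z.
pose l i := k i - s' * p n i - t' * p n.+1 i.
have Hy : y%:~R = (s - s'%:~R) * (q n)%:R + (t - t'%:~R) * (q n.+1)%:R :> R.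
  by rewrite /y !rmorphB !rmorphM /= -!pmulrn Hx; ring.
have Hl i : (l i)%:~R = (s - s'%:~R) * (p n i)%:~R + (t - t'%:~R) * (p n.+1 i)%:~R :> R.
  by rewrite /l !rmorphB !rmorphM /= Hk; ring.
(* Both scalars are at most 1/2 in absolute value, and e_{n+1} < e_n makes the bound strict. *)
have Hyl i : `|theta i * y%:~R - (l i)%:~R| < e n.
  have -> : theta i * y%:~R - (l i)%:~R =
    (s - s'%:~R) * (theta i * (q n)%:R - (p n i)%:~R)
    + (t - t'%:~R) * (theta i * (q n.+1)%:R - (p n.+1 i)%:~R).
    by rewrite Hy Hl; ring.
  apply: le_lt_trans (ler_normD _ _) _; rewrite !normrM.
  have := ba_approx ba n i; have := ba_approx ba n.+1 i.
  have := ba_err_lt ba n.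
  move: Hs Ht (normr_ge0 (s - s'%:~R)) (normr_ge0 (t - t'%:~R)).
  move: (normr_ge0 (theta i * (q n)%:R - (p n i)%:~R)).
  move: (normr_ge0 (theta i * (q n.+1)%:R - (p n.+1 i)%:~R)).
  nra.
have yq : (`|y| < q n.+1)%N.
  rewrite -(ltr_nat R) natr_absz intr_norm Hy.
  apply: le_lt_trans (ler_normD _ _) _; rewrite !normrM !normr_nat.
  have : (q n)%:R < (q n.+1)%:R :> R by rewrite ltr_nat (ba_ltn ba).
  have : 0 < (q n)%:R :> R by rewrite ltr0n (ba_gt0 ba).
  nra.
have y0 : y = 0.
  apply/eqP; apply: contrapT => /negP y0.
  have yq' : (0 < `|y| < q n.+1)%N by rewrite yq absz_gt0 y0.
  (* Minimality concerns positive integers, so the vector is multiplied by the sign of [y]. *)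
  have [i] := ba_min ba (fun i => sgz y * l i) yq'.
  rewrite leNgt => /negP; apply; apply: le_lt_trans (Hyl i).
  have yE : `|y|%N%:R = (sgz y)%:~R * y%:~R :> R.
    by rewrite natr_absz normrEsg sgrz rmorphM.
  have -> : theta i * `|y|%N%:R - (sgz y * l i)%:~R =
      (sgz y)%:~R * (theta i * y%:~R - (l i)%:~R) by rewrite yE rmorphM /=; ring.
  by rewrite normrM -intr_norm normr_sgz y0 mul1r.
have l0 i : l i = 0.
  apply/eqP; rewrite -(intr_eq0 R); apply: contraT => li.
  have := Hyl i; rewrite y0 mulr0 sub0r normrN.
  have := ba_err_le ba (leq0n n); have := ba_err0 ba.
  have : 1 <= `|(l i)%:~R| :> R by rewrite norm_intr_ge1 // intr_int.
  by lra.
move: Hy; rewrite y0 => /esym Hy.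
have [|/eqP + /eqP] := ba_independent ba Hy.
  by move=> i; rewrite -Hl l0.
by rewrite !subr_eq0 => /eqP -> /eqP ->.
Qed.

(** The pair at [m] has integer coordinates in the basis at [n], so its Plücker vector is a nonzero
    integer multiple of the one at [n]. The upper and lower area bounds each cost a factor 2. *)
Lemma ba_area_le {R : realType} {d} {theta : 'I_d -> R} {q p e}
    (ba : best_approximations theta q p e) n m (s t s' t' : R) :
  (q m)%:R = s * (q n)%:R + t * (q n.+1)%:R ->
  (forall i, (p m i)%:~R = s * (p n i)%:~R + t * (p n.+1 i)%:~R) ->
  (q m.+1)%:R = s' * (q n)%:R + t' * (q n.+1)%:R ->
  (forall i, (p m.+1 i)%:~R = s' * (p n i)%:~R + t' * (p n.+1 i)%:~R) ->
  (q n.+1)%:R * e n <= 4 * ((q m.+1)%:R * e m).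
Proof.
move=> Hq Hp Hq' Hp'.
have [a [b [sa tb]]] := ba_basis ba (x := (q m)%:Z) Hq Hp.
have [a' [b' [sa' tb']]] := ba_basis ba (x := (q m.+1)%:Z) Hq' Hp'.
have HM i : (plucker q p m i)%:~R =
    (a * b' - a' * b)%:~R * (plucker q p n i)%:~R :> R.
  rewrite /plucker !rmorphB !rmorphM /= -!pmulrn Hq Hq' Hp Hp' sa tb sa' tb'.
  by ring.
have D0 : (a * b' - a' * b) != 0.
  have [i Hi] := plucker_neq0 ba m; apply: contra Hi => /eqP D0.
  by rewrite -(intr_eq0 R) HM D0 mul0r.
have [i Hi] := plucker_ge ba n; apply: le_trans Hi _.
have := plucker_le ba m i; rewrite HM normrM.
have : 1 <= `|(a * b' - a' * b)%:~R| :> R.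
  by rewrite norm_intr_ge1 ?intr_int // intr_eq0.
move: (normr_ge0 (plucker q p n i)%:~R : 0 <= _ :> R).
nra.
Qed.

(** * Determinants of approximation vectors *)

Definition approx_vec {d} (q : nat -> nat) (p : nat -> 'I_d -> int) n :
    'rV[int]_d.+1 :=
  \row_j (if unlift ord0 j is Some i then p n i else (q n)%:Z).

Lemma approx_vec0 d q (p : nat -> 'I_d -> int) n : approx_vec q p n 0 ord0 = (q n)%:Z.
Proof. by rewrite mxE unlift_none. Qed.

Lemma approx_vec_lift d q (p : nat -> 'I_d -> int) n i :
  approx_vec q p n 0 (lift ord0 i) = p n i.
Proof. by rewrite mxE liftK. Qed.

(** Multiplication by the triangular matrix [U], of determinant 1 or -1, turns the columns of
    numerators into columns of errors. Expansion along the column of denominators then leaves minors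
    made of errors only. *)
Lemma ba_det_le (R : realType) d (theta : 'I_d -> R) q p e
    (ba : best_approximations theta q p e) (idx : 'I_d.+1 -> nat) :
  `|\det (\matrix_(i, j) (approx_vec q p (idx i) 0 j)%:~R : 'M[R]_d.+1)| <=
    \sum_i (q (idx i))%:R * (d`!%:R * \prod_k e (idx (lift i k))).
Proof.
set A := (X in \det X).
pose U : 'M[R]_d.+1 := \matrix_(i, j)
  match unlift ord0 i, unlift ord0 j with
  | None, None => 1
  | None, Some j => theta j
  | Some _, None => 0
  | Some i, Some j => - (i == j)%:R
  end.
have detU : `|\det U| = 1.
  rewrite -det_tr det_trig; last first.
    apply/is_trig_mxP => i j; rewrite !mxE.
    case: (unliftP ord0 j) => [j' ->|->]; last by [].
    case: (unliftP ord0 i) => [i' ->|->] //= lij.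
    by rewrite (_ : j' == i' = false) ?oppr0 //; apply/eqP => E; rewrite E ltnn in lij.
  rewrite normr_prod big1 // => i _; rewrite !mxE.
  by case: (unlift ord0 i) => [i'|]; rewrite ?eqxx ?normrN normr1.
have AU0 i : (A *m U) i ord0 = (q (idx i))%:R.
  rewrite mxE big_ord_recl big1 ?addr0; last first.
    by move=> k _; rewrite !mxE liftK unlift_none mulr0.
  by rewrite !mxE !unlift_none mulr1 pmulrn.
have AUl i j : `|(A *m U) i (lift ord0 j)| <= e (idx i).
  rewrite mxE big_ord_recl (bigD1 j) //= big1 ?addr0; last first.
    by move=> k /negbTE kj; rewrite !mxE !liftK kj oppr0 mulr0.
  rewrite !mxE !unlift_none !liftK eqxx mulrN1 -pmulrn mulrC.
  exact: ba_approx.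
have -> : `|\det A| = `|\det (A *m U)| by rewrite det_mulmx normrM detU mulr1.
rewrite (expand_det_col _ ord0); apply: le_trans (ler_norm_sum _ _ _) _.
apply: ler_sum => i _; rewrite normrM AU0 normr_nat ler_wpM2l //.
rewrite /cofactor normrM normrX normrN1 expr1n mul1r.
apply: norm_det_le => a b; rewrite [row' _ _ _ _]mxE [col' _ _ _ _]mxE.
exact: AUl.
Qed.

(** The determinant is a nonzero integer. Each of the four terms of its expansion is at most 3!
    times the largest denominator and the three largest errors, and 4 * 3! = 24. *)
Lemma ba_det4_le (R : realType) (theta : 'I_3 -> R) q p e
    (ba : best_approximations theta q p e) a n :
  (a < n)%N ->
  \det (rows4 (approx_vec q p a) (approx_vec q p n) (approx_vec q p n.+1)
    (approx_vec q p n.+2)) != 0 ->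
  1 <= 24 * ((q n.+2)%:R * e n.+1 * e n * e a).
Proof.
set A := rows4 _ _ _ _ => an detA.
pose idx (i : 'I_4) := tnth [tuple a; n; n.+1; n.+2] i.
have AE : map_mx intr A = \matrix_(i, j) (approx_vec q p (idx i) 0 j)%:~R :> 'M[R]_4.
  apply/matrixP => i j; rewrite !mxE; congr (_%:~R).
  by case: i => -[|[|[|[|//]]]] Hi /=; rewrite /idx !(tnth_nth 0) /= ?mxE.
have : 1 <= `|\det (map_mx intr A : 'M[R]_4)|.
  by rewrite det_map_mx norm_intr_ge1 ?intr_int // intr_eq0.
move=> /le_trans; apply; rewrite AE; apply: le_trans (ba_det_le ba idx) _.
rewrite !big_ord_recl !big_ord0 /idx !(tnth_nth 0%N) /= !mulr1 addr0.
have e0 k : 0 <= e k := ltW (ba_err_gt0 ba k).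
have qm k l : (k <= l)%N -> (q k)%:R <= (q l)%:R :> R.
  by move=> kl; rewrite ler_nat (ba_leq ba).
have em k l : (k <= l)%N -> e l <= e k := @ba_err_le _ _ _ _ _ _ ba k l.
have an' := ltnW an.
pose X := (q n.+2)%:R * (e a * (e n * e n.+1)).
have X0 : (q a)%:R * (e n * (e n.+1 * e n.+2)) <= X.
  by rewrite /X; repeat apply: ler_pM => //; rewrite ?mulr_ge0 //; (apply: qm || apply: em); lia.
have X1 : (q n)%:R * (e a * (e n.+1 * e n.+2)) <= X.
  by rewrite /X; repeat apply: ler_pM => //; rewrite ?mulr_ge0 //; (apply: qm || apply: em); lia.
have X2 : (q n.+1)%:R * (e a * (e n * e n.+2)) <= X.
  by rewrite /X; repeat apply: ler_pM => //; rewrite ?mulr_ge0 //; (apply: qm || apply: em); lia.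
have -> : (q n.+2)%:R * e n.+1 * e n * e a = X by rewrite /X; ring.
have -> : 3`!%:R = 6 :> R by [].
by rewrite !(mulrCA _ 6) -/X; lra.
Qed.

(** * Best approximation vectors span the whole space *)

Lemma clear_denominators n (c : 'I_n -> rat) :
  exists N (C : 'I_n -> int), N != 0 /\ forall i, (C i)%:~R = N%:~R * c i :> rat.
Proof.
exists (\prod_i denq (c i)), (fun i => numq (c i) * \prod_(j | j != i) denq (c j)).
split; first by apply/prodf_neq0 => i _; exact: denq_neq0.
by move=> i; rewrite [in RHS](bigD1 i) //= !rmorphM /= numqE; ring.
Qed.

(** A rational functional that kills the tail gives an integer form [S] in 1 and the theta_i such
    that q_j S is a combination of errors, hence bounded. As q_j is unbounded, [S] is 0, against
    independence. *)
Lemma ba_separated (R : realType) d (theta : 'I_d -> R) q p e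
    (ba : best_approximations theta q p e) m (c : 'cV[rat]_d.+1) :
  (forall (C0 : int) (C : 'I_d -> int),
    C0%:~R + \sum_i (C i)%:~R * theta i = 0 -> C0 = 0 /\ forall i, C i = 0) ->
  c != 0 ->
  exists2 j, (m <= j)%N & map_mx intr (approx_vec q p j) *m c != 0.
Proof.
move=> indep c0; apply: contrapT => nex.
have cz j : (m <= j)%N -> map_mx intr (approx_vec q p j) *m c = 0.
  by move=> mj; apply/eqP; apply: contrapT => /negP zj; apply: nex; exists j.
have [N [C [N0 HC]]] := clear_denominators (fun i => c i ord0).
have Hz j : (m <= j)%N ->
    C ord0 * (q j)%:Z + \sum_i C (lift ord0 i) * p j i = 0.
  move=> mj; apply/eqP; rewrite -(intr_eq0 rat) rmorphD rmorph_sum /= rmorphM /=.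
  rewrite HC; have := congr1 (fun M : 'M[rat]_1 => N%:~R * M ord0 ord0) (cz j mj).
  rewrite !mxE mulr0 big_ord_recl mulrDr mulr_sumr => H.
  apply/eqP; rewrite -[RHS]H; congr (_ + _).
    by rewrite !mxE unlift_none; ring.
  by apply: eq_bigr => i _; rewrite !mxE liftK rmorphM /= HC; ring.
have e1 j : e j <= 1.
  by apply: le_trans (ba_err_le ba (leq0n j)) _; apply: le_trans (ba_err0 ba) _; lra.
pose B := \sum_i `|(C (lift ord0 i))%:~R| : R.
pose S := (C ord0)%:~R + \sum_i (C (lift ord0 i))%:~R * theta i.
have SB j : (m <= j)%N -> (q j)%:R * `|S| <= B.
  move=> mj; rewrite -[(q j)%:R]normr_nat -normrM.
  have -> : (q j)%:R * S =
      \sum_i (C (lift ord0 i))%:~R * (theta i * (q j)%:R - (p j i)%:~R).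
    have : (C ord0 * (q j)%:Z + \sum_i C (lift ord0 i) * p j i)%:~R = 0 :> R.
      by rewrite Hz.
    rewrite rmorphD rmorph_sum /= rmorphM /= -pmulrn => H.
    under eq_bigr do rewrite mulrBr -rmorphM.
    rewrite sumrB /S mulrDr mulr_sumr [X in _ = _ - X](_ : _ = - ((C ord0)%:~R * (q j)%:R)).
      by rewrite opprK addrC; congr (_ + _); [apply: eq_bigr => i _|]; ring.
    by apply/eqP; rewrite -addr_eq0 addrC H.
  apply: le_trans (ler_norm_sum _ _ _) _; apply: ler_sum => i _.
  by rewrite normrM ler_piMr // (le_trans (ba_approx ba j i)).
have S0 : S = 0.
  apply/eqP; rewrite -normr_eq0; apply: contraT => S0.
  have Sp : 0 < `|S| by rewrite lt_neqAle eq_sym S0 /=.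
  have := archi_boundP (divr_ge0 (sumr_ge0 _ (fun i _ => normr_ge0 _) : 0 <= B) (ltW Sp)).
  set k := Num.bound _ => Hk.
  have := SB (m + k)%N (leq_addr _ _); rewrite leNgt => /negP []; rewrite -ltr_pdivrMr //.
  apply: lt_le_trans Hk _; rewrite ler_nat.
  by apply: leq_trans (ltnW (ba_index_lt ba _)); rewrite leq_addl.
have [C0 Cl] := indep _ _ S0.
case/negP: c0; apply/eqP/colP => i; rewrite mxE.
have Ci : C i = 0 by case: (unliftP ord0 i) => [j ->|->].
by have := HC i; rewrite Ci => /esym/eqP; rewrite mulf_eq0 intr_eq0 (negbTE N0) => /eqP.
Qed.

(** * Record minima and the construction of best approximations *)

(** The sequence iterates, from 1, the map that sends [n] to the least positive [x] with
    [f x < f n]. *)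
Lemma record_sequence (R : realDomainType) (f : nat -> R) :
  (forall x, (0 < x)%N -> exists2 y, (0 < y)%N & f y < f x) ->
  exists q : nat -> nat, [/\ q 0%N = 1%N, forall n, (q n < q n.+1)%N,
    forall n, f (q n.+1) < f (q n) &
    forall n x, (0 < x < q n.+1)%N -> f (q n) <= f x].
Proof.
move=> fdec.
have next n : exists x, (0 < n)%N -> [/\ (0 < x)%N, f x < f n &
    forall y, (0 < y < x)%N -> f n <= f y].
  have [->|n0] := posnP n; first by exists 0%N.
  have exP : exists x, (0 < x)%N && (f x < f n).
    by have [y y0 fy] := fdec _ n0; exists y; rewrite y0.
  case: (ex_minnP exP) => x /andP[x0 fx] xmin; exists x => _; split=> // y /andP[y0 yx].
  rewrite leNgt; apply/negP => fy; have := xmin y.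
  by rewrite y0 fy => /(_ isT); rewrite leqNgt yx.
have [s Hs] := choice next.
(* A record is strictly below all earlier values, which forces the next record to have a larger
   index. *)
have Inv n : (0 < iter n s 1)%N /\
    forall y, (0 < y < iter n s 1)%N -> f (iter n s 1%N) < f y.
  elim: n => [|n [n0 IH]] /=; first by split=> // y; lia.
  have [s0 fs smin] := Hs _ n0; split=> // y /smin; exact: lt_le_trans.
exists (fun n => iter n s 1%N); split=> // n; have [n0 IH] := Inv n.
- have [s0 fs _] := Hs _ n0; rewrite /= ltnNge leq_eqVlt; apply/negP => /orP[/eqP E|sn].
    by rewrite E ltxx in fs.
  by have := lt_trans fs (IH _ (introT andP (conj s0 sn))); rewrite ltxx.
- by have [_ fs _] := Hs _ n0.
- by have [_ _ smin] := Hs _ n0.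
Qed.

Lemma dnint_le (R : realType) (u : R) (k : int) : dnint u <= `|u - k%:~R|.
Proof.
have := floor_itv u; rewrite /dnint rmorphD /=.
set m := Num.floor u => /andP[mu um]; rewrite ge_min.
have [km|mk] := lerP k m; apply/orP; [left|right].
  have : k%:~R <= m%:~R :> R by rewrite ler_int.
  by move=> ?; rewrite ger0_norm; lra.
have : (m + 1)%:~R <= k%:~R :> R by rewrite ler_int; lia.
by rewrite rmorphD /= => ?; rewrite ler0_norm; lra.
Qed.

Lemma dnint_attained (R : realType) (u : R) : exists k : int, dnint u = `|u - k%:~R|.
Proof.
have := floor_itv u; rewrite /dnint rmorphD /=.
set m := Num.floor u => /andP[mu um]; rewrite minEle; case: ifP => _.
  by exists m; rewrite ger0_norm //; lra.
by exists (m + 1); rewrite rmorphD /= ler0_norm; lra.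
Qed.

Lemma dnint_le_half (R : realType) (u : R) : dnint u <= 2^-1.
Proof.
by have [k /(le_trans (dnint_le u k))] := nearest_int u.
Qed.

Definition theta3 {R : realType} (t1 t2 t3 : R) : 'I_3 -> R := tnth [tuple t1; t2; t3].

Lemma maxdist_ge (R : realType) (t1 t2 t3 : R) x i :
  dnint (theta3 t1 t2 t3 i * x%:R) <= maxdist t1 t2 t3 x.
Proof.
rewrite /maxdist !le_max /theta3 (tnth_nth 0).
by case: i => -[|[|[|//]]] Hi /=; rewrite lexx ?orbT.
Qed.

Lemma maxdist_attained (R : realType) (t1 t2 t3 : R) x :
  exists i, maxdist t1 t2 t3 x = dnint (theta3 t1 t2 t3 i * x%:R).
Proof.
rewrite /maxdist; set a := dnint _; set b := dnint _; set c := dnint _.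
have [_|_] := leP a (Num.max b c); last by exists (inord 0); rewrite /theta3 (tnth_nth 0) inordK.
have [_|_] := leP b c; last by exists (inord 1); rewrite /theta3 (tnth_nth 0) inordK.
by exists (inord 2); rewrite /theta3 (tnth_nth 0) inordK.
Qed.

Lemma maxdist_gt0 (R : realType) (t1 t2 t3 : R) x :
  Zlin_indep4 t1 t2 t3 -> (0 < x)%N -> 0 < maxdist t1 t2 t3 x.
Proof.
move=> ind x0; apply: lt_le_trans (maxdist_ge t1 t2 t3 x ord0).
rewrite /theta3 (tnth_nth 0) /=.
have [k Hk] := dnint_attained (t1 * x%:R); rewrite Hk normr_gt0; apply/negP => /eqP H.
have [|_ x00 _ _] := ind (- k) x%:Z 0 0.
  by rewrite rmorphN /= -pmulrn; lra.
by case: x x00 x0 {Hk H}.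
Qed.

Lemma psi_attained (R : realType) (t1 t2 t3 t : R) : 1 <= t ->
  exists x, [/\ (0 < x)%N, x%:R <= t & psi t1 t2 t3 t = maxdist t1 t2 t3 x].
Proof.
move=> t1'; rewrite /psi big_seq.
elim/big_ind: _ => [|_ _ [x [x0 xt ->]] [y [y0 yt ->]]|x].
- by exists 1%N.
- by rewrite minEle; case: ifP => _; [exists x|exists y].
rewrite mem_index_iota => /andP[x0 xt]; exists x; split=> //.
by rewrite -truncn_ge_nat // ?(le_trans ler01).
Qed.

Lemma psi_le (R : realType) (t1 t2 t3 t : R) x : (0 < x)%N -> x%:R <= t ->
  psi t1 t2 t3 t <= maxdist t1 t2 t3 x.
Proof.
move=> x0 xt; have t0 : 0 <= t by apply: le_trans xt.
apply: ge_bigmin_seq => //.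
by rewrite mem_index_iota x0 ltnS truncn_ge_nat.
Qed.

Lemma theta3_independent (R : realType) (t1 t2 t3 : R) :
  Zlin_indep4 t1 t2 t3 -> forall (C0 : int) (C : 'I_3 -> int),
  C0%:~R + \sum_i (C i)%:~R * theta3 t1 t2 t3 i = 0 -> C0 = 0 /\ forall i, C i = 0.
Proof.
move=> ind C0 C; rewrite !big_ord_recl big_ord0 addr0 /theta3 !(tnth_nth 0) /= !addrA.
move=> /ind[-> c0 c1 c2]; split=> // -[[|[|[|//]]] Hi].
- by rewrite -c0; congr (C _); exact: val_inj.
- by rewrite -c1; congr (C _); exact: val_inj.
- by rewrite -c2; congr (C _); exact: val_inj.
Qed.

(** A positive [gam] makes [psi] tend to 0, while independence keeps [maxdist] positive at each
    [x]. *)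
Lemma maxdist_decrease (R : realType) (t1 t2 t3 gam : R) x :
  Zlin_indep4 t1 t2 t3 -> 0 < gam -> limsup_finite t1 t2 t3 gam -> (0 < x)%N ->
  exists2 y, (0 < y)%N & maxdist t1 t2 t3 y < maxdist t1 t2 t3 x.
Proof.
move=> ind gam0 [C [T HC]] x0; have fx := maxdist_gt0 ind x0.
(* Once t^gam >= [a], the bound [C] forces [psi] below [maxdist] at [x]; the maximum with 0 keeps
   [a] positive, so that its power can be inverted. *)
pose a := Num.max 0 (C / maxdist t1 t2 t3 x) + 1.
have Ca : C / maxdist t1 t2 t3 x < a by rewrite /a ltr_pwDr // le_max lexx orbT.
have a0 : 0 < a by rewrite /a ltr_wpDl // le_max lexx.
pose t := Num.max T (Num.max 1 (a `^ gam^-1)).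
have tT : T <= t by rewrite le_max lexx.
have t1' : 1 <= t by rewrite !le_max lexx orbT.
have ta : a <= t `^ gam.
  have -> : a = (a `^ gam^-1) `^ gam.
    by rewrite -powRrM mulVf ?gt_eqF // powRr1 // ltW.
  apply: ge0_ler_powR; rewrite ?nnegrE ?powR_ge0 ?(ltW gam0) //.
    exact: le_trans t1'.
  by rewrite !le_max lexx !orbT.
have [y [y0 _ psiy]] := psi_attained t1 t2 t3 t1'; exists y => //.
rewrite ltNge; apply/negP => fxy; have := HC t tT t1'; rewrite psiy.
apply/negP; rewrite -ltNge; move: Ca; rewrite ltr_pdivrMr // => /lt_le_trans; apply.
by apply: ler_pM => //; apply: ltW.
Qed.

Lemma ba_exists (R : realType) (t1 t2 t3 gam : R) :
  Zlin_indep4 t1 t2 t3 -> 0 < gam -> limsup_finite t1 t2 t3 gam ->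
  exists q p, best_approximations (theta3 t1 t2 t3) q p (fun n => maxdist t1 t2 t3 (q n)).
Proof.
move=> ind gam0 lf; have fdec x := maxdist_decrease ind gam0 lf (x := x).
have [q [q0 qlt flt fmin]] := record_sequence fdec.
have qpos n : (0 < q n)%N by elim: n => [|n IH]; [rewrite q0|exact: ltn_trans (qlt n)].
have pex (ni : nat * 'I_3) : exists k : int, dnint (theta3 t1 t2 t3 ni.2 * (q ni.1)%:R)
  = `|theta3 t1 t2 t3 ni.2 * (q ni.1)%:R - k%:~R| by exact: dnint_attained.
have [p Hp] := choice pex.
exists q, (fun n i => p (n, i)); split=> //.
- by have [i ->] := maxdist_attained t1 t2 t3 (q 0%N); exact: dnint_le_half.
- by move=> n; apply: maxdist_gt0.
- by move=> n i; have /= <- := Hp (n, i); exact: maxdist_ge.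
- move=> n x k xq; have [i Hi] := maxdist_attained t1 t2 t3 x; exists i.
  by apply: le_trans (fmin _ _ xq) _; rewrite Hi; exact: dnint_le.
Qed.

(** At t = q_{n+1} - 1 the minimum [psi] is still at least e_n, so t^gam e_n <= [C]. Replacing t by
    q_{n+1} <= 2t costs the constant [gam * ln 2]. *)
Lemma ba_uniform (R : realType) (t1 t2 t3 gam : R) q p :
  best_approximations (theta3 t1 t2 t3) q p (fun n => maxdist t1 t2 t3 (q n)) ->
  limsup_finite t1 t2 t3 gam -> 0 < gam ->
  exists k n0, forall n, (n0 <= n)%N ->
    ln (maxdist t1 t2 t3 (q n)) <= k - gam * ln (q n.+1)%:R.
Proof.
move=> ba [C [T HC]] gam0; exists (ln C + gam * ln 2), (Num.bound (Num.max 0 T)).+1 => n nT.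
have nq := ba_index_lt ba n; have nq1 := ba_ltn ba n.
pose t : R := (q n.+1).-1%:R.
have tq : (q n.+1)%:R = t + 1 :> R by rewrite /t natr1 prednK // (ba_gt0 ba).
have t1' : 1 <= t by rewrite ler1n; lia.
have tT : T <= t.
  have M0 : 0 <= Num.max 0 T by rewrite le_max lexx.
  have TM : T <= Num.max 0 T by rewrite le_max lexx orbT.
  by apply: le_trans TM (le_trans (ltW (archi_boundP M0)) _); rewrite ler_nat; lia.
have [x [x0 xt psix]] := psi_attained t1 t2 t3 t1'.
have en : maxdist t1 t2 t3 (q n) <= maxdist t1 t2 t3 x.
  have xq : (0 < x < q n.+1)%N by move: xt; rewrite x0 ler_nat; lia.
  have [i Hi] := maxdist_attained t1 t2 t3 x; rewrite Hi.
  have Hk i' := dnint_attained (theta3 t1 t2 t3 i' * x%:R).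
  have [k {}Hk] := choice Hk.
  have [i' /le_trans] := ba_min ba k xq; apply; rewrite -Hk -Hi; exact: maxdist_ge.
have e0 := ba_err_gt0 ba n; rewrite /= in e0.
have tp : 0 < t := lt_le_trans ltr01 t1'.
have le_C : t `^ gam * maxdist t1 t2 t3 (q n) <= C.
  by apply: le_trans (HC t tT t1'); rewrite psix ler_wpM2l ?powR_ge0.
have tg : 0 < t `^ gam by rewrite powR_gt0.
have C0 : 0 < C by apply: lt_le_trans le_C; rewrite mulr_gt0.
have : ln (t `^ gam * maxdist t1 t2 t3 (q n)) <= ln C by rewrite ler_ln ?posrE ?mulr_gt0.
rewrite lnM ?posrE // ln_powR.
have : ln (q n.+1)%:R <= ln 2 + ln t.
  rewrite -lnM ?posrE // ler_ln ?posrE ?mulr_gt0 ?tq //; by lra.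
by move=> /(ler_wpM2l (ltW gam0)); lra.
Qed.

(** * Growth of the denominators *)

(** Under the contrary assumption all estimates become linear inequalities between logarithms of
    denominators, which together bound ln q_{a+2} by g K / eps, although [a] can be taken
    arbitrarily large. *)
Lemma ba_growth (R : realType) (theta : 'I_3 -> R) q p e (gam g k : R) n0 :
  best_approximations theta q p e ->
  (forall (C0 : int) (C : 'I_3 -> int),
    C0%:~R + \sum_i (C i)%:~R * theta i = 0 -> C0 = 0 /\ forall i, C i = 0) ->
  0 < g -> 0 < gam <= 1 -> g ^+ 2 < gam * (1 + g + g ^+ 2) ->
  (forall n, (n0 <= n)%N -> ln (e n) <= k - gam * ln (q n.+1)%:R) ->
  forall m, exists2 j, (m <= j)%N & g * ln (q j)%:R <= ln (q j.+1)%:R.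
Proof.
move=> ba indep g0 /andP[gam0 gam1] gg Hk m; apply: contrapT => nj.
have slow j : (m <= j)%N -> ln (q j.+1)%:R < g * ln (q j)%:R :> R.
  by move=> mj; rewrite ltNge; apply/negP => gj; apply: nj; exists j.
pose eps := gam * (1 + g + g ^+ 2) - g ^+ 2.
have eps0 : 0 < eps by rewrite subr_gt0.
(* The constants come from the determinant, the area comparison and the uniform bounds on e_a,
   e_{a+1}, e_{n+1}. *)
pose K : R := ln 24 + ln 4 + k + k + k.
have [N [Nm Nn0 NB]] : exists N, [/\ (m <= N)%N, (n0 <= N)%N &
    (Num.bound (expR (g * K / eps)) <= N)%N].
  exists (maxn (maxn n0 m) (Num.bound (expR (g * K / eps)))).
  by rewrite !leq_max !leqnn !orbT.
pose z j : 'rV[rat]_4 := map_mx intr (approx_vec q p j).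
have zq j : z j 0 ord0 = (q j)%:R by rewrite !mxE unlift_none -pmulrn.
have zp j i : z j 0 (lift ord0 i) = (p j i)%:~R by rewrite !mxE liftK.
have zE i j l s t : (s *: z j + t *: z l) 0 i = s * z j 0 i + t * z l 0 i.
  by rewrite !mxE.
have zind j s t : s *: z j + t *: z j.+1 = 0 -> s = 0 /\ t = 0.
  move=> /rowP H; apply: (ba_independent ba (n := j)).
    by have := H ord0; rewrite zE !zq mxE.
  by move=> i; have := H (lift ord0 i); rewrite zE !zp mxE.
have zsep (c : 'cV_4) : c != 0 -> exists2 j, (N <= j)%N & z j *m c != 0.
  exact: ba_separated ba _ _ indep.
have [a [n [/andP[Na an] span1 span2 det0]]] := four_independent zind zsep.
have toR j : (exists s t, z j = s *: z n + t *: z n.+1) -> exists s t : R,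
    (q j)%:R = s * (q n)%:R + t * (q n.+1)%:R /\
    forall i, (p j i)%:~R = s * (p n i)%:~R + t * (p n.+1 i)%:~R.
  move=> [s [t /rowP H]]; exists (ratr s), (ratr t); split=> [|i].
    have := congr1 (ratr : rat -> R) (H ord0).
    by rewrite zE !zq rmorphD !rmorphM /= !ratr_nat.
  have := congr1 (ratr : rat -> R) (H (lift ord0 i)).
  by rewrite zE !zp rmorphD !rmorphM /= !ratr_int.
have [s1 [r1 [Hq1 Hp1]]] := toR _ span1.
have [s2 [r2 [Hq2 Hp2]]] := toR _ span2.
have area := ba_area_le ba Hq1 Hp1 Hq2 Hp2.
have det1 : 1 <= 24 * ((q n.+2)%:R * e n.+1 * e n * e a).
  apply: (ba_det4_le ba an); apply: contra det0 => /eqP det0.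
  rewrite (_ : rows4 _ _ _ _ = map_mx intr (rows4 (approx_vec q p a)
    (approx_vec q p n) (approx_vec q p n.+1) (approx_vec q p n.+2))).
    by rewrite det_map_mx det0.
  apply/matrixP => i j; rewrite !mxE.
  by case: i => -[|[|[|[|//]]]] Hi; rewrite !(tnth_nth 0) /= mxE.
have Q j : 0 < (q j)%:R :> R by rewrite ltr0n (ba_gt0 ba).
have E j : 0 < e j by exact: ba_err_gt0 ba j.
have ldet : 0 <= ln 24 + (ln (q n.+2)%:R + ln (e n.+1) + ln (e n) + ln (e a)).
  by rewrite -!lnM ?posrE ?mulr_gt0 // ln_ge0.
have larea : ln (q n.+1)%:R + ln (e n) <= ln 4 + (ln (q a.+2)%:R + ln (e a.+1)).
  by rewrite -!lnM ?posrE ?mulr_gt0 // ler_ln ?posrE ?mulr_gt0.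
have Na2 : (N <= a.+2)%N by rewrite (leq_trans Na) // -addn2 leq_addr.
have Na1 : (N <= a.+1)%N by exact: leqW.
have Nn1 : (N <= n.+1)%N by rewrite (leq_trans Na1) // ltnW.
have bc : ln (q a.+2)%:R <= ln (q n.+1)%:R :> R.
  by rewrite ler_ln ?posrE // ler_nat (ba_leq ba).
have bK : g * K / eps < ln (q a.+2)%:R.
  rewrite -[X in X < _]expRK ltr_ln ?posrE ?expR_gt0 //.
  apply: lt_le_trans (archi_boundP (ltW (expR_gt0 _))) _; rewrite ler_nat.
  exact: leq_trans (leq_trans NB Na2) (ltnW (ba_index_lt ba _)).
have sa := slow _ (leq_trans Nm Na1); have sn := slow _ (leq_trans Nm Nn1).
have Ha := Hk _ (leq_trans Nn0 Na); have Ha1 := Hk _ (leq_trans Nn0 Na1).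
have Hn1 := Hk _ (leq_trans Nn0 Nn1).
move: bK; rewrite ltr_pdivrMr //.
have main : 0 <= K + (1 - gam) * ln (q n.+2)%:R + (1 - gam) * ln (q a.+2)%:R
    - ln (q n.+1)%:R - gam * ln (q a.+1)%:R by rewrite /K; lra.
have d_le : (1 - gam) * ln (q n.+2)%:R <= (1 - gam) * (g * ln (q n.+1)%:R).
  by rewrite ler_wpM2l ?subr_ge0 // ltW.
have a_ge : gam * ln (q a.+2)%:R <= gam * (g * ln (q a.+1)%:R).
  by rewrite ler_wpM2l ?ltW.
(* If (1 - gam) g >= 1, then g <= (1 - gam) g^2 < gam (1 + g), hence (1 - gam) g < gam <= 1. The
   sign allows q_{n+1} to be replaced by the smaller q_{a+2}. *)
have coef : (1 - gam) * g - 1 < 0.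
  rewrite ltNge; apply/negP => H; have := mulr_ge0 (ltW g0) H.
  by move: gg; rewrite !expr2; lra.
have c_le : ((1 - gam) * g - 1) * ln (q n.+1)%:R <= ((1 - gam) * g - 1) * ln (q a.+2)%:R.
  by rewrite ler_wnM2l // ltW.
move: main d_le a_ge c_le; rewrite /eps.
move: (ln (q n.+2)%:R) (ln (q n.+1)%:R) (ln (q a.+2)%:R) (ln (q a.+1)%:R) => d c b a'.
move=> main d_le a_ge c_le; apply/negP; rewrite -leNgt.
(* After multiplication by [g] and elimination of d, c and a', the coefficient of b = ln q_{a+2} is
   -eps. *)
have := ler_wpM2l (ltW g0) main; rewrite mulr0.
have := ler_wpM2l (ltW g0) d_le; have := ler_wpM2l (ltW g0) c_le.
by rewrite !expr2; lra.
Qed.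

(** At t = q_j the minimum is at most e_j <= e^k q_{j+1}^{-gam} <= e^k q_j^{-gam g}. *)
Lemma liminf_finite_from_growth (R : realType) (t1 t2 t3 gam g k : R) q p n0 :
  best_approximations (theta3 t1 t2 t3) q p (fun n => maxdist t1 t2 t3 (q n)) ->
  0 < gam ->
  (forall n, (n0 <= n)%N -> ln (maxdist t1 t2 t3 (q n)) <= k - gam * ln (q n.+1)%:R) ->
  (forall m, exists2 j, (m <= j)%N & g * ln (q j)%:R <= ln (q j.+1)%:R :> R) ->
  liminf_finite t1 t2 t3 (gam * g).
Proof.
move=> ba gam0 Hk grow; exists (expR k) => T.
have M0 : 0 <= Num.max 0 T by rewrite le_max lexx.
have [j jm Hj] := grow (maxn n0 (Num.bound (Num.max 0 T))).
have q0 := ba_gt0 ba j; exists (q j)%:R; split.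
  have TM : T <= Num.max 0 T by rewrite le_max lexx orbT.
  apply: le_trans TM (le_trans (ltW (archi_boundP M0)) _).
  by rewrite ler_nat; have := ba_index_lt ba j; lia.
split; first by rewrite ler1n.
have e0 := ba_err_gt0 ba j; rewrite /= in e0.
apply: le_trans (ler_wpM2l (powR_ge0 _ _) (psi_le t1 t2 t3 q0 (lexx _))) _.
rewrite -ler_ln ?posrE ?expR_gt0 ?mulr_gt0 ?powR_gt0 ?ltr0n // expRK.
rewrite lnM ?posrE ?powR_gt0 ?ltr0n // ln_powR -mulrA.
have := Hk j (ltac: (lia)); have := ler_wpM2l (ltW gam0) Hj; lra.
Qed.

(** * Dirichlet's theorem and positivity of the uniform exponent *)

(** Pigeonhole: the fractional parts for x = 0, ..., N^3 give N^3 + 1 points in N^3 cubes of side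
    1/N, and the difference of two indices sharing a cube is the required [x]. *)
Lemma dirichlet_maxdist (R : realType) (t1 t2 t3 : R) N : (0 < N)%N ->
  exists x, (0 < x <= N ^ 3)%N /\ maxdist t1 t2 t3 x <= N%:R^-1.
Proof.
case: N => // N _; pose th := theta3 t1 t2 t3.
pose fr u : R := u - (Num.floor u)%:~R.
have fr0 u : 0 <= fr u by rewrite subr_ge0 floor_le.
have fr1 u : fr u < 1 by have := floorD1_gt u; rewrite rmorphD /= /fr; lra.
pose f (x : 'I_(N.+1 ^ 3).+1) : {ffun 'I_3 -> 'I_N.+1} :=
  [ffun i => inord (Num.truncn (N.+1%:R * fr (th i * x%:R)))].
have [x [y [xy fxy]]] : exists x y : 'I_(N.+1 ^ 3).+1, (x < y)%N /\ f x = f y.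
  apply: contrapT => nxy; have : injective f.
    move=> x y fxy; apply: val_inj; apply: contrapT => /eqP.
    by rewrite neq_ltn => /orP[] ?; apply: nxy; [exists x, y|exists y, x].
  by move/leq_card; rewrite card_ffun !card_ord ltnn.
exists (y - x)%N; split; first by have := ltn_ord y; lia.
have [i ->] := maxdist_attained t1 t2 t3 (y - x)%N; rewrite -/th.
apply: le_trans (dnint_le _ (Num.floor (th i * y%:R) - Num.floor (th i * x%:R))) _.
have -> : th i * (y - x)%:R - (Num.floor (th i * y%:R) - Num.floor (th i * x%:R))%:~R
   = fr (th i * y%:R) - fr (th i * x%:R).
  by rewrite natrB ?(ltnW xy) // rmorphB /= /fr; ring.
have := congr1 (fun h : {ffun 'I_3 -> 'I_N.+1} => val (h i)) fxy; rewrite !ffunE /=.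
have N0 : 0 < N.+1%:R :> R by rewrite ltr0n.
have trN u : (Num.truncn (N.+1%:R * fr u) < N.+1)%N.
  by rewrite truncn_lt_nat ?mulr_ge0 // gtr_pMr.
rewrite !inordK // => tr.
have := truncn_itv (mulr_ge0 (ltW N0) (fr0 (th i * x%:R))).
have := truncn_itv (mulr_ge0 (ltW N0) (fr0 (th i * y%:R))).
rewrite tr -[(Num.truncn _).+1%:R]natr1 => /andP[? ?] /andP[? ?].
rewrite -[leRHS]mul1r ler_pdivlMr // -[X in _ * X]gtr0_norm // -normrM.
by rewrite mulrBl ![_ * N.+1%:R]mulrC ler_norml; apply/andP; split; lra.
Qed.

(** Dirichlet's theorem is applied with N the integer part of s = t^{1/3}; s < N + 1 <= 2N gives the
    constant 2. *)
Lemma dirichlet_exponent (R : realType) (t1 t2 t3 : R) :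
  limsup_finite t1 t2 t3 3^-1.
Proof.
exists 2, 1 => t _ t1'; have t0 : 0 < t := lt_le_trans ltr01 t1'.
set s := t `^ 3^-1.
have s1 : 1 <= s by rewrite -(powRr0 t) ler_powR.
have s3 : s ^+ 3 = t by rewrite -powR_mulrn ?powR_ge0 // -powRrM mulVf // powRr1 // ltW.
have N0 : (0 < Num.truncn s)%N by rewrite truncn_gt0.
have [x [/andP[x0 xN] fx]] := dirichlet_maxdist t1 t2 t3 N0.
have /andP[Ns sN] := truncn_itv (le_trans ler01 s1).
have xt : x%:R <= t.
  rewrite -s3; apply: (le_trans (y := (Num.truncn s ^ 3)%:R)); first by rewrite ler_nat.
  by rewrite natrX lerXn2r ?nnegrE ?(le_trans ler01 s1).
have := le_trans (psi_le t1 t2 t3 x0 xt) fx.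
have Np : 0 < (Num.truncn s)%:R :> R by rewrite ltr0n.
move=> /(ler_wpM2l (le_trans ler01 s1))/le_trans; apply.
rewrite ler_pdivrMr //; move: sN; rewrite -natr1.
have : 1 <= (Num.truncn s)%:R :> R by rewrite ler1n.
lra.
Qed.

(** * Passage to the exponents *)

Lemma uniform_to_ordinary (R : realType) (t1 t2 t3 gam g : R) :
  Zlin_indep4 t1 t2 t3 -> 0 < gam <= 1 -> limsup_finite t1 t2 t3 gam ->
  0 < g -> g ^+ 2 < gam * (1 + g + g ^+ 2) ->
  ((gam * g)%:E <= beta_exp t1 t2 t3)%E.
Proof.
move=> ind gam01 lf g0 gg; have /andP[gam0 _] := gam01.
have [q [p ba]] := ba_exists ind gam0 lf.
have [k [n0 Hk]] := ba_uniform ba lf gam0.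
have grow := ba_growth ba (theta3_independent ind) g0 gam01 gg Hk.
apply: ereal_sup_ubound; exists (gam * g) => //; split; first exact: mulr_gt0.
exact: liminf_finite_from_growth ba gam0 Hk grow.
Qed.

Lemma g3_gt0 (R : realType) (a : R) : 0 < a < 1 -> 0 < g3 a.
Proof.
move=> /andP[a0 a1]; have r0 : 0 < a / (1 - a) by rewrite divr_gt0 // subr_gt0.
by rewrite /g3 /=; have := sqrtr_ge0 ((a / (1 - a)) ^+ 2 + 4 * (a / (1 - a))); lra.
Qed.

(** With r = a / (1 - a), the condition reads g^2 < r (1 + g), and [g3 a] is the positive root of
    g^2 = r g + r. *)
Lemma lt_g3 (R : realType) (a g : R) : 0 < a < 1 -> 0 < g -> g < g3 a ->
  g ^+ 2 < a * (1 + g + g ^+ 2).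
Proof.
move=> /andP[a0 a1] g0; rewrite /g3 /=; set r := a / (1 - a).
have a1' : 0 < 1 - a by rewrite subr_gt0.
have r0 : 0 < r by rewrite divr_gt0.
have ra : r * (1 - a) = a by rewrite /r divfK // gt_eqF.
rewrite ltr_pdivlMr // => H.
suff : g ^+ 2 < r * (1 + g) by nra.
have [neg|pos] := ltP (2 * g - r) 0; first by nra.
have D0 : 0 <= r ^+ 2 + 4 * r by nra.
have : (2 * g - r) ^+ 2 < r ^+ 2 + 4 * r.
  rewrite -[ltRHS]sqr_sqrtr // ltrXn2r // ?nnegrE ?sqrtr_ge0 //; lra.
nra.
Qed.

Theorem theorem5 (R : realType) (t1 t2 t3 : R) :
  Zlin_indep4 t1 t2 t3 ->
  ((alpha_exp t1 t2 t3 < 1%:E)%E ->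
     ((fine (alpha_exp t1 t2 t3) * g3 (fine (alpha_exp t1 t2 t3)))%:E
        <= beta_exp t1 t2 t3)%E)
  /\ (alpha_exp t1 t2 t3 = 1%:E -> beta_exp t1 t2 t3 = +oo%E).
Proof.
move=> ind.
(* The supremum need not be attained, so the argument runs with admissible [gam] close to it. *)
have approach c : (c%:E < alpha_exp t1 t2 t3)%E -> (alpha_exp t1 t2 t3 <= 1%:E)%E ->
    exists gam, [/\ c < gam, 0 < gam <= 1 & limsup_finite t1 t2 t3 gam].
  move=> /ereal_sup_gt[_ [gam [gam0 lf] <-] cgam] alpha1; exists gam; split=> //.
  rewrite gam0 -lee_fin; apply: le_trans alpha1.
  by apply: ereal_sup_ubound; exists gam.
split=> [|alpha1]; last first.
  (* As g^2 / (1 + g + g^2) < 1, any [g] is allowed for [gam] near 1; [gam] > 1/2 and g = 2M give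
     gam g >= M. *)
  apply/eqyP => M M0; pose g := 2 * M.
  have g0 : 0 < g by rewrite mulr_gt0.
  have d0 : 0 < 1 + g + g ^+ 2 by nra.
  pose c := Num.max (g ^+ 2 / (1 + g + g ^+ 2)) 2^-1.
  have c1 : c < 1 by rewrite gt_max ltr_pdivrMr // mul1r; apply/andP; split; lra.
  have [||gam [cgam gam01 lf]] := approach c; rewrite ?alpha1 ?lte_fin //.
  move: cgam; rewrite gt_max ltr_pdivrMr // => /andP[gg gam2].
  apply: le_trans (uniform_to_ordinary ind gam01 lf g0 gg); rewrite lee_fin /g.
  by nra.
have alpha0 : ((3^-1)%:E <= alpha_exp t1 t2 t3)%E.
  apply: ereal_sup_ubound; exists 3^-1 => //; split; last exact: dirichlet_exponent.
  by rewrite invr_gt0.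
case: (alpha_exp t1 t2 t3) alpha0 approach => [a||] //=; rewrite lee_fin lte_fin.
move=> a0 approach a1; have {}a0 : 0 < a by apply: lt_le_trans a0.
have a01 : 0 < a < 1 by rewrite a0.
have G0 := g3_gt0 a01; rewrite leNgt; apply/negP => beta_lt.
(* A nonnegative real bound [b] replaces the exponent, which could formally be -oo as a supremum of
   the empty set. *)
have [b [b0 bG beta_b]] : exists b, [/\ 0 <= b, b < a * g3 a & (beta_exp t1 t2 t3 <= b%:E)%E].
  case: (beta_exp t1 t2 t3) beta_lt => [r||] //=; rewrite ?lte_fin => rG; last first.
    by exists 0; rewrite mulr_gt0 ?leNye.
  exists (Num.max r 0); rewrite lee_fin !le_max gt_max !lexx rG orbT.
  by rewrite mulr_gt0.
(* The midpoint gives both b < a g and g < g3(a); these strict inequalities persist for [gam]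
   slightly below [a]. *)
pose g := (b / a + g3 a) / 2.
have ba0 : 0 <= b / a by rewrite divr_ge0 // ltW.
have bag : b / a < g3 a by rewrite ltr_pdivrMr // mulrC.
have g0 : 0 < g by rewrite /g; lra.
have gG : g < g3 a by rewrite /g; lra.
have bg : b < a * g by rewrite mulrC -ltr_pdivrMr // /g; lra.
have d0 : 0 < 1 + g + g ^+ 2 by nra.
have [||gam [cgam gam01 lf]] :=
    approach (Num.max (g ^+ 2 / (1 + g + g ^+ 2)) (b / g)).
- by rewrite lte_fin gt_max !ltr_pdivrMr // bg lt_g3.
- by rewrite lee_fin ltW.
move: cgam; rewrite gt_max !ltr_pdivrMr // => /andP[gg bgam].
have := le_trans (uniform_to_ordinary ind gam01 lf g0 gg) beta_b.
by rewrite lee_fin leNgt bgam.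
Qed.
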